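(* Let $K$ be a $b$-complete commutative idempotent semiring, let $\{V_\alpha\}_{\alpha\in A}$ be an arbitrary family of $b$-complete idempotent semimodules over $K$, let $W$ be an arbitrary $b$-complete semimodule over $K$, and let $V=\prod_\alpha V_\alpha$ be the direct product. Let $\pi\colon V\to\bigotimes_\alpha V_\alpha$, $\pi(x)=\{x\}^\tau$, i.e. $\pi(\{x_\alpha\})=\bigotimes_\alpha x_\alpha$, be the canonical mapping. The canonical mapping $\{x_\alpha\}\mapsto\bigotimes_\alpha x_\alpha$ of the direct product $V=\prod_\alpha V_\alpha$ of the semimodules $V_\alpha$ into the $b$-tensor product $T_b(V)=\bigotimes_\alpha V_\alpha$ of these semimodules is $b$-polylinear. For each $b$-polylinear mapping $f\colon\prod_\alpha V_\alpha\to W$ there exists a unique $b$-linear mapping $f_\otimes\colon\bigotimes_\alpha V_\alpha\to W$ such that $f=f_\otimes\pi$.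
   Context: **Basics.** An idempotent semigroup is a commutative semigroup $(S,\oplus)$ with $x\oplus x=x$; it is ordered by $x\preccurlyeq y\iff x\oplus y=y$, so $x\oplus y=\sup\{x,y\}$. For a subset $X$, $\oplus X$ denotes $\sup X$; ''bounded'' means bounded above. $S$ is $b$-complete if each bounded subset (possibly empty) has a least upper bound; then $S$ has the zero $\mathbf 0=\oplus\emptyset$. An idempotent semiring $K$ is an idempotent semigroup with an associative multiplication $\odot$, distributive on both sides, with unit $\mathbf 1$ and zero $\mathbf 0\ne\mathbf 1$. $K$ is $b$-complete if it is $b$-complete as a semigroup and $k\odot(\oplus X)=\oplus(k\odot X)$, $(\oplus X)\odot k=\oplus(X\odot k)$ for all $k\in K$ and all bounded $X\subset K$. An idempotent semimodule over $K$ is an idempotent semigroup $V$ with an associative multiplication by elements of $K$ that is distributive and satisfies $\mathbf 1\odot x=x$. It is $b$-complete if it is $b$-complete as a semigroup and $(\oplus Q)\odot x=\oplus(Q\odot x)$, $k\odot(\oplus X)=\oplus(k\odot X)$ for all $k\in K$, $x\in V$ and all bounded $Q\subset K$, $X\subset V$. A map $p$ between $b$-complete semimodules is $b$-linear if $p(x\oplus y)=p(x)\oplus p(y)$, $p(k\odot x)=k\odot p(x)$ and $p(\oplus X)=\oplus p(X)$ for every bounded subset $X$. Direct products carry componentwise operations. **$b$-polylinear.** A map $f\colon\prod_\alpha V_\alpha\to W$ is $b$-polylinear if for every index $\beta$ and arbitrary fixed values of all other coordinates, $x_\beta\mapsto f(\dots,x_\beta,\dots)$ is a $b$-linear map $V_\beta\to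 W$. **Tensors.** For $k\in K$ and $\alpha\in A$, $k_\alpha\colon V\to V$ multiplies the $\alpha$-th component by $k$ and leaves the others unchanged. A subset $S\subset V$ is an $\alpha$-fiber (or simply a fiber) if all components of its elements with index $\beta\ne\alpha$ are fixed, while the $\alpha$-th component takes arbitrary values in $V_\alpha$. A tensor is a subset $X\subset V$ with the following properties: 1) if $k_\alpha(x)\in X$ for some $\alpha\in A$ and $k\in K$, then $k_\beta(x)\in X$ for all $\beta\in A$; 2) $\oplus(X\cap S)\in X$ for each fiber $S\subset V$; 3) for each fiber $S\subset V$, if $y\in S$, $x\in X\cap S$ and $y\preccurlyeq x$, then $y\in X$. It is assumed that a tensor always contains $\mathbf 0_V$ (formally corresponding to $\sup\emptyset=\mathbf 0_V$). The $\tau$-hull $X^\tau$ of a subset $X\subset V$ is the intersection of all tensors containing $X$. **$b$-tensor product.** A $b$-tensor (bounded tensor) is a tensor contained in $\{x\}^\tau$ for some $x\in V$. $T_b(V)$ is the set of all $b$-tensors ordered by inclusion; this order gives rise to the idempotent addition, the sum of a bounded family being the $\tau$-hull of its union, and $k\odot X=(k_\alpha(X))^\tau$ (independent of the choice of $\alpha$). With these operations $T_b(V)$ is a $b$-complete semimodule over $K$, identified with the $b$-tensor product $\bigotimes_\alpha V_\alpha$; the element $\{x\}^\tau$ with $x=\{x_\alpha\}$ is written $\bigotimes_\alpha x_\alpha$.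
   Formalization: A is nonempty; b-tensors are tensors contained in {x_1,...,x_n}^τ, and tensors contain all vectors with a zero component: for finite A nothing changes, for infinite A the printed T_b(V) need not be closed under ⊕ or satisfy 0⊙X=0. Axiom 2 is read for all subsets of X∩S having a sum. *)

(* Defs.v *)
From HB Require Import structures.
From mathcomp Require Import all_boot all_algebra.
From mathcomp Require Import boolp classical_sets.

Set Implicit Arguments.
Unset Strict Implicit.
Unset Printing Implicit Defensive.

Import GRing.Theory.
Local Open Scope classical_set_scope.
Local Open Scope ring_scope.

Section Order.
Context {M : nmodType}.
Implicit Types (x y u s : M) (X S : set M).

(* The order of an idempotent semigroup. *)
Definition ile x y : Prop := x + y = y.

Definition is_ub X u : Prop := forall x, X x -> ile x u.

Definition bounded X : Prop := exists u, is_ub X u.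

(* s is the least upper bound of X within the ordered subset S. *)
Definition is_sup_in S X s : Prop :=
  [/\ S s, is_ub X s & forall u, S u -> is_ub X u -> ile s u].

Definition is_sup X s : Prop := is_sup_in setT X s.

(* The sum of all elements of X; meaningful when X has a supremum. *)
Definition bsup X : M := xget 0 (is_sup X).

Lemma ile_anti x y : ile x y -> ile y x -> x = y.
Proof. by rewrite /ile => xy yx; rewrite -yx addrC xy. Qed.

Lemma ile_trans y x z : ile x y -> ile y z -> ile x z.
Proof. by rewrite /ile => xy yz; rewrite -yz addrA xy. Qed.

Lemma ile0x x : ile 0 x.
Proof. exact: add0r. Qed.

Lemma is_supP X s :
  is_ub X s -> (forall u, is_ub X u -> ile s u) -> is_sup X s.
Proof. by move=> ub least; split=> // u _; exact: least. Qed.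

Lemma is_sup_bsup X s : is_sup X s -> bsup X = s.
Proof.
move=> [_ ub least]; rewrite /bsup; case: xgetP => [t -> [_ ubt leastt]|none].
  by apply: ile_anti; [exact: leastt | exact: least].
by have := none s; case.
Qed.

End Order.

HB.mixin Record isBComplete M of GRing.Nmodule M := {
  addrr_id : forall x : M, x + x = x;
  ex_sup : forall X : set M, bounded X -> exists s, is_sup X s
}.

#[short(type="bNmodType")]
HB.structure Definition BNmodule := {M of GRing.Nmodule M & isBComplete M}.

HB.mixin Record isBSemiRing K of GRing.ComNzSemiRing K & BNmodule K := {
  mulr_bsupr : forall (k : K) (X : set K), bounded X ->
    k * bsup X = bsup [set k * x | x in X];
  mulr_bsupl : forall (k : K) (X : set K), bounded X ->
    bsup X * k = bsup [set x * k | x in X]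
}.

(* b-complete commutative idempotent semirings *)
#[short(type="bComSemiRingType")]
HB.structure Definition BComSemiRing :=
  {K of GRing.ComNzSemiRing K & isBComplete K & isBSemiRing K}.

HB.mixin Record isBSemiModule (K : bComSemiRingType) V
    of GRing.LSemiModule K V & BNmodule V := {
  scaler_bsupl : forall (Q : set K) (x : V), bounded Q ->
    bsup Q *: x = bsup [set k *: x | k in Q];
  scaler_bsupr : forall (k : K) (X : set V), bounded X ->
    k *: bsup X = bsup [set k *: x | x in X]
}.

(* b-complete idempotent semimodules over K *)
#[short(type="bSemiModType")]
HB.structure Definition BSemiModule (K : bComSemiRingType) :=
  {V of GRing.LSemiModule K V & isBComplete V & isBSemiModule K V}.

Section BCompleteTheory.
Context {M : bNmodType}.
Implicit Types (x y : M) (X : set M).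

Lemma ilexx x : ile x x.
Proof. exact: addrr_id. Qed.

Lemma ile_addr x y : ile x (x + y).
Proof. by rewrite /ile addrA addrr_id. Qed.

Lemma ile_addl x y : ile y (x + y).
Proof. by rewrite addrC; exact: ile_addr. Qed.

Lemma ile_add x y z : ile x z -> ile y z -> ile (x + y) z.
Proof. by rewrite /ile => xz yz; rewrite -addrA yz xz. Qed.

Lemma bsupP X : bounded X -> is_sup X (bsup X).
Proof. by move=> /ex_sup[s sX]; rewrite (is_sup_bsup sX). Qed.

Lemma bsup_ub X x : bounded X -> X x -> ile x (bsup X).
Proof. by move=> /bsupP[_ ub _]; exact: ub. Qed.

Lemma bsup_least X u : bounded X -> is_ub X u -> ile (bsup X) u.
Proof. by move=> /bsupP[_ _ least]; exact: least. Qed.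

Lemma bsup0 : bsup (set0 : set M) = 0.
Proof. by apply: is_sup_bsup; apply: is_supP => // u _; exact: ile0x. Qed.

Lemma bounded2 x y : bounded [set x; y].
Proof. by exists (x + y) => z [->|->]; [exact: ile_addr | exact: ile_addl]. Qed.

Lemma bsup2 x y : bsup [set x; y] = x + y.
Proof.
apply: is_sup_bsup; apply: is_supP => [z [->|->]|u ub].
- exact: ile_addr.
- exact: ile_addl.
- by apply: ile_add; apply: ub; [left | right].
Qed.

End BCompleteTheory.

Section Maps.
Context {K : bComSemiRingType}.

Definition b_linear (V W : bSemiModType K) (p : V -> W) : Prop :=
  [/\ forall x y, p (x + y) = p x + p y,
      forall k x, p (k *: x) = k *: p x &
      forall X : set V, bounded X -> p (bsup X) = bsup (p @` X)].

(* [dfwith x v] is x with its a-th component replaced by v : V_ a. *)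
Definition b_polylinear (A : choiceType) (V_ : A -> bSemiModType K)
    (W : bSemiModType K) (f : (forall a, V_ a) -> W) : Prop :=
  forall (a : A) (x : forall a, V_ a), b_linear (fun v : V_ a => f (dfwith x v)).

End Maps.

(* The additive structure, hence the order, of a direct product. *)
Section Product.
Context {A : Type} (V_ : A -> nmodType).

Definition prod_zero : forall a, V_ a := fun a => 0.
Definition prod_add (x y : forall a, V_ a) : forall a, V_ a :=
  fun a => x a + y a.

Lemma prod_addA : associative prod_add.
Proof. by move=> x y z; apply: functional_extensionality_dep => a; exact: addrA. Qed.
Lemma prod_addC : commutative prod_add.
Proof. by move=> x y; apply: functional_extensionality_dep => a; exact: addrC. Qed.
Lemma prod_add0 : left_id prod_zero prod_add.
Proof. by move=> x; apply: functional_extensionality_dep => a; exact: add0r. Qed.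

HB.instance Definition _ :=
  GRing.isNmodule.Build (forall a, V_ a) prod_addA prod_addC prod_add0.

Lemma prod_ileP (x y : forall a, V_ a) : ile x y <-> forall a, ile (x a) (y a).
Proof.
split=> [xy a|xy]; last by apply: functional_extensionality_dep => a; exact: xy.
exact: (congr1 (fun z : forall a, V_ a => z a) xy).
Qed.

End Product.

Section Tensors.
Context {K : bComSemiRingType} {A : choiceType} (V_ : A -> bSemiModType K).
Let V := forall a, V_ a.
Implicit Types (x y z : V) (X Y S T : set V).

Definition scale_at (k : K) (a : A) x : V := dfwith x (k *: x a).

Definition is_fiber (a : A) S : Prop :=
  exists z, S = [set y | forall b, b != a -> y b = z b].

(* Unbounded sets have no sum, and X may meet a fiber S in an unbounded set;
   so [tensor_sup] closes X under the sums of all Y `<=` X `&` S for which the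
   sum exists.  The sum is taken in S, so that Y = set0 yields the point of S
   whose a-th component is 0.  For a finite family this point is in X anyway, by
   [tensor_scale] and [tensor0]; for an infinite one it need not be, and without
   it 0 *: X would not be the least tensor. *)
Record tensor X : Prop := Tensor {
  tensor_scale : forall a k x, X (scale_at k a x) -> forall b, X (scale_at k b x);
  tensor_sup : forall a S Y s, is_fiber a S -> Y `<=` X `&` S ->
    is_sup_in S Y s -> X s;
  tensor_down : forall a S x y, is_fiber a S -> (X `&` S) x -> S y ->
    ile y x -> X y;
  tensor0 : X 0
}.

Definition hull X : set V := smallest tensor X.

Definition b_tensor X : Prop := tensor X /\ exists x, X `<=` hull [set x].

(* The tensors bounded by a finite sum of sets hull [set x].  For a finite
   family V_ these are exactly the b-tensors, as [finite_bsum_tensorP] shows. For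
   an infinite family the b-tensors alone are not closed under addition:
   [tensor_down] changes one component at a time, so hull [set x] and
   hull [set y] need not lie in a common hull [set z]. *)
Definition bsum_tensor X : Prop :=
  tensor X /\ exists s : seq V, X `<=` hull [set` s].

Record btensor := BTensor {
  btensor_set :> set V;
  btensor_subproof : bsum_tensor btensor_set
}.

HB.instance Definition _ := gen_eqMixin btensor.
HB.instance Definition _ := gen_choiceMixin btensor.

Lemma btensor_ext (X Y : btensor) : X = Y :> set V -> X = Y.
Proof.
case: X Y => X hX [Y hY] /= XY; case: _ / XY hY => hY.
by congr BTensor; exact: Prop_irrelevance.
Qed.

Lemma btensor_tensor (X : btensor) : tensor X.
Proof. by case: X => X []. Qed.

Lemma dfwith_id x a : dfwith x (x a) = x.
Proof.
by apply: functional_extensionality_dep => b; case: dfwithP.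
Qed.

Lemma dfwithE_fiber a x y : (forall b, b != a -> y b = x b) -> dfwith x (y a) = y.
Proof.
move=> yx; apply: functional_extensionality_dep => b.
by case: dfwithP => // c; rewrite eq_sym => /yx ->.
Qed.

Lemma dfwith2 a x (u v : V_ a) : dfwith (dfwith x u) v = dfwith x v.
Proof.
apply: functional_extensionality_dep => b.
by case: dfwithP => [|c ac]; [rewrite dfwith_in | rewrite !dfwith_out].
Qed.

Lemma dfwithC a b x (u : V_ a) (v : V_ b) : a != b ->
  dfwith (dfwith x u) v = dfwith (dfwith x v) u.
Proof.
move=> ab; apply: functional_extensionality_dep => c.
case: (dfwithP (dfwith x u) v c) => [|d bd].
  by rewrite dfwith_out // dfwith_in.
case: (eqVneq a d) bd => [<- ba|ad bd]; first by rewrite !dfwith_in.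
by rewrite !dfwith_out.
Qed.

Lemma dfwith_ile a x (u v : V_ a) : ile u v -> ile (dfwith x u) (dfwith x v).
Proof.
move=> uv; apply/prod_ileP => b; have [<-|ab] := eqVneq a b.
  by rewrite !dfwith_in.
by rewrite !dfwith_out//; exact: ilexx.
Qed.

Lemma tensor_dfwith_le X a x (u v : V_ a) : tensor X ->
  ile u v -> X (dfwith x v) -> X (dfwith x u).
Proof.
move=> tX uv Xv.
apply: (tensor_down tX (a := a) (S := [set y | forall b, b != a -> y b = x b]))
  (dfwith_ile x uv).
- by exists x.
- by split=> //= b ba; rewrite dfwith_out 1?eq_sym.
- by move=> /= b ba; rewrite dfwith_out 1?eq_sym.
Qed.

Lemma tensor_dfwith_bsup X a x (Y : set (V_ a)) : tensor X -> bounded Y ->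
  (forall v, Y v -> X (dfwith x v)) -> X (dfwith x (bsup Y)).
Proof.
move=> tX bY YX.
apply: (tensor_sup tX (a := a) (S := [set y | forall b, b != a -> y b = x b])
  (Y := [set dfwith x v | v in Y])).
- by exists x.
- move=> _ [v Yv <-]; split; first exact: YX.
  by move=> /= b ba; rewrite dfwith_out 1?eq_sym.
- split.
  + by move=> /= b ba; rewrite dfwith_out 1?eq_sym.
  + by move=> _ [v Yv <-]; apply: dfwith_ile; exact: bsup_ub.
  + move=> u /= /dfwithE_fiber <- ub; apply: dfwith_ile; apply: bsup_least => //.
    move=> v Yv; have /prod_ileP/(_ a) := ub _ (ex_intro2 _ _ _ Yv erefl).
    by rewrite !dfwith_in.
Qed.

Lemma tensor_dfwith0 X a x : tensor X -> X (dfwith x (0 : V_ a)).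
Proof.
move=> tX; rewrite -bsup0; apply: tensor_dfwith_bsup => //.
by exists 0.
Qed.

Lemma mk_tensor X :
  (forall a k x, X (scale_at k a x) -> forall b, X (scale_at k b x)) ->
  (forall a x (Y : set (V_ a)), bounded Y ->
    (forall v, Y v -> X (dfwith x v)) -> X (dfwith x (bsup Y))) ->
  (forall a x (u v : V_ a), ile u v -> X (dfwith x v) -> X (dfwith x u)) ->
  X 0 -> tensor X.
Proof.
move=> Xk Xsup Xle X0; split=> //.
- move=> a _ Y s [z ->] YXS [/= Ss ub least].
  pose Ya := [set y a | y in Y].
  have YE y : Y y -> dfwith s (y a) = y.
    by move=> /YXS[_ /= Sy]; apply: dfwithE_fiber => b ba; rewrite Sy ?Ss.
  have bYa : bounded Ya.
    by exists (s a) => _ [y Yy <-]; have /prod_ileP := ub _ Yy; exact.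
  suff <- : dfwith s (bsup Ya) = s.
    by apply: Xsup => // _ [y Yy <-]; rewrite (YE _ Yy); case: (YXS _ Yy).
  apply: ile_anti.
    rewrite -[X in ile _ X](dfwith_id s a); apply: dfwith_ile.
    apply: bsup_least => // _ [y Yy <-]; have /prod_ileP := ub _ Yy; exact.
  apply: least => [b ba|y Yy]; first by rewrite dfwith_out 1?eq_sym// Ss.
  by rewrite -(YE _ Yy); apply: dfwith_ile; apply: bsup_ub => //; exists y.
- move=> a _ x y [z ->] [Xx /= Sx] /= Sy /prod_ileP yx.
  have <- : dfwith x (y a) = y by apply: dfwithE_fiber => b ba; rewrite Sy ?Sx.
  by apply: (Xle _ _ _ (x a)) => //; rewrite dfwith_id.
Qed.

Lemma hull_tensor X : tensor (hull X).
Proof.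
split.
- by move=> a k x xX b T [tT XT]; apply: (tensor_scale tT (xX T _)).
- move=> a S Y s fS YXS sup T [tT XT]; apply: (tensor_sup tT fS _ sup).
  by move=> y /YXS[hy Sy]; split=> //; exact: hy.
- move=> a S x y fS [xX Sx] Sy yx T [tT XT].
  by apply: (tensor_down tT fS _ Sy yx); split=> //; exact: xX.
- by move=> T [tT _]; exact: tensor0.
Qed.

Lemma sub_hull X : X `<=` hull X.
Proof. by move=> x Xx T [_]; exact. Qed.

Lemma hull_min X T : tensor T -> X `<=` T -> hull X `<=` T.
Proof. by move=> tT XT x; apply. Qed.

Lemma hull_sub X Y : X `<=` hull Y -> hull X `<=` hull Y.
Proof. exact: hull_min (@hull_tensor Y). Qed.

Lemma hull_mono X Y : X `<=` Y -> hull X `<=` hull Y.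
Proof. by move=> XY; apply: hull_sub => x /XY; exact: sub_hull. Qed.

Lemma hull_id T : tensor T -> hull T = T.
Proof. by move=> tT; apply/seteqP; split; [exact: hull_min | exact: sub_hull]. Qed.

Lemma hullUl X Y : hull (hull X `|` Y) = hull (X `|` Y).
Proof.
apply/seteqP; split.
  apply: hull_sub => x [|Yx]; last by apply: sub_hull; right.
  by apply: hull_mono => z Xz; left.
by apply: hull_mono => x [Xx|Yx]; [left; exact: sub_hull | right].
Qed.

Lemma hullUr X Y : hull (X `|` hull Y) = hull (X `|` Y).
Proof. by rewrite setUC hullUl setUC. Qed.

Lemma scale_atA k l a x : scale_at k a (scale_at l a x) = scale_at (k * l) a x.
Proof. by rewrite /scale_at dfwith2 dfwith_in scalerA. Qed.

Lemma scale_atC k l a b x :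
  scale_at k a (scale_at l b x) = scale_at l b (scale_at k a x).
Proof.
have [->|ab] := eqVneq a b; first by rewrite !scale_atA mulrC.
have ba : b != a by rewrite eq_sym.
by rewrite /scale_at (dfwith_out _ _ ba) (dfwith_out _ _ ab) dfwithC.
Qed.

Lemma ile_scaler (W : bSemiModType K) (k : K) (u v : W) :
  ile u v -> ile (k *: u) (k *: v).
Proof. by rewrite /ile -scalerDr => ->. Qed.

Lemma tensor_preimage_scale T k a :
  tensor T -> tensor [set x | T (scale_at k a x)].
Proof.
move=> tT; apply: mk_tensor => /=.
- move=> b l x; rewrite !(scale_atC k) => h c.
  by rewrite (scale_atC k); exact: (tensor_scale tT h).
- move=> b x Y bY; rewrite /scale_at; case: (eqVneq a b) Y bY => [<-|ab] Y bY.
    move=> YT; rewrite dfwith_in dfwith2 scaler_bsupr//.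
    apply: tensor_dfwith_bsup => //; last first.
      by move=> _ [v Yv <-]; have := YT _ Yv; rewrite dfwith_in dfwith2.
    by case: bY => u ub; exists (k *: u) => _ [v Yv <-]; apply/ile_scaler/ub.
  have ba : b != a by rewrite eq_sym.
  move=> YT; rewrite dfwith_out// dfwithC//; apply: tensor_dfwith_bsup => // v Yv.
  by have := YT _ Yv; rewrite dfwith_out// dfwithC.
- move=> b x u v uv; rewrite /scale_at.
  case: (eqVneq a b) u v uv => [<-|ab] u v uv.
    by rewrite !dfwith_in !dfwith2; apply: tensor_dfwith_le => //; exact: ile_scaler.
  have ba : b != a by rewrite eq_sym.
  by rewrite !dfwith_out// !(dfwithC _ _ _ ba); exact: tensor_dfwith_le.
- suff -> : scale_at k a 0 = 0 by exact: tensor0.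
  by rewrite /scale_at scaler0; exact: dfwith_id.
Qed.

Lemma hull_scale k a X :
  hull (scale_at k a @` hull X) = hull (scale_at k a @` X).
Proof.
apply/seteqP; split; last first.
  by apply: hull_mono => _ [x Xx <-]; exists x => //; exact: sub_hull.
apply: hull_sub => _ [x Xx <-].
apply: (Xx [set x | hull _ (scale_at k a x)]); split.
  by apply: tensor_preimage_scale; exact: hull_tensor.
by move=> z Xz; apply: sub_hull; exists z.
Qed.

Lemma hull_scale_indep k a b X :
  hull (scale_at k a @` X) = hull (scale_at k b @` X).
Proof.
suff le c d : hull (scale_at k c @` X) `<=` hull (scale_at k d @` X).
  by apply/seteqP; split; exact: le.
apply: hull_sub => _ [x Xx <-].
apply: (tensor_scale (@hull_tensor (scale_at k d @` X)) (a := d)).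
by apply: sub_hull; exists x.
Qed.

Lemma finite_bsum_tensorP (e : seq A) X :
  (forall a, a \in e) -> bsum_tensor X <-> b_tensor X.
Proof.
move=> Ae.
have mono x y : ile x y -> hull [set y] x.
  move=> /prod_ileP xy; pose z (r : seq A) : V := fun a => if a \in r then x a else y a.
  suff : hull [set y] (z e).
    congr (hull _ _); apply: functional_extensionality_dep => a.
    by rewrite /z Ae.
  elim: e {Ae} => [|a r IH]; first exact: sub_hull.
  have zE : dfwith (z r) (x a) = z (a :: r).
    apply: functional_extensionality_dep => b.
    case: dfwithP => [|c ac]; rewrite /z inE ?eqxx//.
    by rewrite eq_sym (negPf ac).
  rewrite -zE; apply: (@tensor_dfwith_le (hull [set y]) a (z r) (x a) (z r a)).
  - exact: hull_tensor.
  - by rewrite /z; case: ifP => _; [exact: ilexx | exact: xy].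
  - by rewrite dfwith_id.
split=> -[tX]; last first.
  move=> [x Xx]; split=> //; exists [:: x].
  by apply: subset_trans Xx _; apply: hull_mono => _ ->; rewrite /= inE.
move=> [s Xs]; split=> //; exists (\sum_(x <- s) x).
apply: subset_trans Xs _; apply: hull_sub => x /= xs; apply: mono.
apply/prod_ileP => a; elim: s xs => // y s IH.
rewrite inE big_cons => /orP[/eqP ->|/IH xs]; first exact: ile_addr.
exact: ile_trans xs (ile_addl _ _).
Qed.

End Tensors.

(* A is pointed, i.e. nonempty: scalars act on a tensor through some component,
   so that the empty product carries no scalar action. *)
Section BTensorProduct.
Context {K : bComSemiRingType} {A : pointedType} (V_ : A -> bSemiModType K).
Let V := forall a, V_ a.
Local Notation T := (btensor V_).
Implicit Types (X Y Z : T).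

Lemma bsum_zero : bsum_tensor (hull (set0 : set V)).
Proof. by split; [exact: hull_tensor | exists [::]; exact: hull_mono]. Qed.

Lemma bsum_add X Y : bsum_tensor (hull (X `|` Y : set V)).
Proof.
split; first exact: hull_tensor.
case: X Y => [X [? [s Xs]]] [Y [? [t Yt]]] /=; exists (s ++ t); apply: hull_sub.
by move=> x [/Xs xs|/Yt xt]; [move: xs|move: xt]; apply: hull_mono => z /= zs;
  rewrite mem_cat zs ?orbT.
Qed.

Lemma bsum_scale (k : K) a X : bsum_tensor (hull (scale_at k a @` (X : set V))).
Proof.
split; first exact: hull_tensor.
case: X => [X [? [s Xs]]] /=; exists (map (scale_at k a) s).
apply: (@subset_trans _ (hull (scale_at k a @` hull [set` s]))).
  by apply: hull_mono => _ [x /Xs Xx <-]; exists x.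
rewrite hull_scale; apply: hull_mono => _ [x /= xs <-]; exact: map_f.
Qed.

Definition btensor_zero : T := BTensor bsum_zero.
Definition btensor_add X Y : T := BTensor (bsum_add X Y).

(* By [hull_scale_indep] the choice of the index [point] does not matter. *)
Definition btensor_scale (k : K) X : T := BTensor (bsum_scale k point X).

Lemma btensor_addA : associative btensor_add.
Proof. by move=> X Y Z; apply: btensor_ext; rewrite /= hullUr hullUl setUA. Qed.

Lemma btensor_addC : commutative btensor_add.
Proof. by move=> X Y; apply: btensor_ext; rewrite /= setUC. Qed.

Lemma btensor_add0 : left_id btensor_zero btensor_add.
Proof.
move=> X; apply: btensor_ext; rewrite /= hullUl set0U hull_id//.
exact: btensor_tensor.
Qed.

HB.instance Definition _ :=
  GRing.isNmodule.Build T btensor_addA btensor_addC btensor_add0.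

Lemma btensor_ileP X Y : ile X Y <-> (X : set V) `<=` Y.
Proof.
split=> [<- x Xx|XY]; first by apply: sub_hull; left.
apply: btensor_ext => /=; rewrite (setUidr XY) hull_id//; exact: btensor_tensor.
Qed.

Lemma btensor_scale_sub k X Y :
  (btensor_scale k X : set V) `<=` Y <->
  (forall x, (X : set V) x -> (Y : set V) (scale_at k point x)).
Proof.
split=> [XY x Xx|XY]; first by apply: XY; apply: sub_hull; exists x.
by apply: hull_min; [exact: btensor_tensor | move=> _ [x Xx <-]; exact: XY].
Qed.

Lemma btensor_scalerA a b X :
  btensor_scale a (btensor_scale b X) = btensor_scale (a * b) X.
Proof.
apply: btensor_ext; rewrite /= hull_scale image_comp; congr hull.
by apply: eq_imagel => x _ /=; rewrite scale_atA.
Qed.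

Lemma btensor_scale0r X : btensor_scale 0 X = 0.
Proof.
apply: ile_anti; last exact: ile0x.
apply/btensor_ileP/btensor_scale_sub => x _; rewrite /scale_at scale0r.
by apply: tensor_dfwith0; exact: btensor_tensor.
Qed.

Lemma btensor_scale1r : left_id 1 btensor_scale.
Proof.
move=> X; apply: btensor_ext => /=.
rewrite -[RHS]hull_id; last exact: btensor_tensor.
congr hull; rewrite -[RHS]image_id; apply: eq_imagel => x _.
by rewrite /scale_at scale1r dfwith_id.
Qed.

Lemma btensor_scalerDr : right_distributive btensor_scale +%R.
Proof.
move=> k X Y; apply: btensor_ext.
by rewrite /= hull_scale hullUl hullUr image_setU.
Qed.

Lemma btensor_scalerDl X : {morph btensor_scale^~ X : k l / k + l}.
Proof.
move=> k l; apply: ile_anti.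
  apply/btensor_ileP/btensor_scale_sub => x Xx; rewrite /scale_at scalerDl -bsup2.
  apply: tensor_dfwith_bsup; [exact: btensor_tensor | exact: bounded2 |].
  move=> v vE; apply: sub_hull; case: vE => ->; [left|right];
    by apply: sub_hull; exists x.
suff le m : ile m (k + l) -> ile (btensor_scale m X) (btensor_scale (k + l) X).
  have /btensor_ileP h1 := le k (ile_addr _ _).
  have /btensor_ileP h2 := le l (ile_addl _ _).
  apply/btensor_ileP; apply: hull_min; first exact: btensor_tensor.
  by move=> x [/h1|/h2].
move=> mkl; apply/btensor_ileP/btensor_scale_sub => x Xx.
apply: (@tensor_dfwith_le _ _ V_ (hull _) point x (m *: x point)
  ((k + l) *: x point)).
- exact: hull_tensor.
- by rewrite /ile -scalerDl mkl.
- by apply: sub_hull; exists x.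
Qed.

HB.instance Definition _ := GRing.Nmodule_isLSemiModule.Build K T
  btensor_scalerA btensor_scale0r btensor_scale1r btensor_scalerDr
  btensor_scalerDl.

Lemma btensor_addrr X : X + X = X.
Proof. by apply/btensor_ileP. Qed.

Lemma btensor_is_sup (F : set T) Z :
  (Z : set V) = hull (\bigcup_(X in F) (X : set V)) -> is_sup F Z.
Proof.
move=> ZE; apply: is_supP => [X FX|Y ub]; apply/btensor_ileP; rewrite ZE.
  by move=> x Xx; apply: sub_hull; exists X.
apply: hull_min; first exact: btensor_tensor.
by move=> x [X FX Xx]; have /btensor_ileP := ub _ FX; apply.
Qed.

Lemma bsum_bigcup (F : set T) : bounded F ->
  bsum_tensor (hull (\bigcup_(X in F) (X : set V))).
Proof.
move=> [[Y [tY [s Ys]]] ub]; split; first exact: hull_tensor.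
exists s; apply: (subset_trans (B := Y)) (Ys); apply: hull_min => // x [X FX Xx].
by have /btensor_ileP := ub _ FX; apply.
Qed.

Lemma btensor_ex_sup (F : set T) : bounded F -> exists Z, is_sup F Z.
Proof. by move=> /bsum_bigcup bF; exists (BTensor bF); exact: btensor_is_sup. Qed.

HB.instance Definition _ := isBComplete.Build T btensor_addrr btensor_ex_sup.

Lemma btensor_bsupE (F : set T) : bounded F ->
  (bsup F : set V) = hull (\bigcup_(X in F) (X : set V)).
Proof.
by move=> /bsum_bigcup bF; rewrite (@is_sup_bsup _ F (BTensor bF)) //;
  exact: btensor_is_sup.
Qed.

Lemma btensor_scale_bsupl (Q : set K) X : bounded Q ->
  bsup Q *: X = bsup [set k *: X | k in Q].
Proof.
move=> bQ; apply/esym/is_sup_bsup/is_supP => [_ [k Qk <-]|Y ub].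
  by have := bsup_ub bQ Qk; rewrite /ile -scalerDl => ->.
apply/btensor_ileP/btensor_scale_sub => x Xx.
rewrite /scale_at scaler_bsupl//; apply: tensor_dfwith_bsup.
- exact: btensor_tensor.
- exists (bsup Q *: x point) => _ [k Qk <-].
  by have := bsup_ub bQ Qk; rewrite /ile -scalerDl => ->.
- move=> _ [k Qk <-]; have /btensor_ileP := ub _ (ex_intro2 _ _ _ Qk erefl).
  by move/btensor_scale_sub; exact.
Qed.

Lemma btensor_scale_bsupr (k : K) (F : set T) : bounded F ->
  k *: bsup F = bsup [set k *: X | X in F].
Proof.
move=> bF; apply/esym/is_sup_bsup/is_supP => [_ [X FX <-]|Y ub].
  by have := bsup_ub bF FX; rewrite /ile -scalerDr => ->.
apply/btensor_ileP/btensor_scale_sub => x; rewrite btensor_bsupE// => Fx.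
apply: (Fx [set x | (Y : set V) (scale_at k point x)]); split.
  by apply: tensor_preimage_scale; exact: btensor_tensor.
move=> z [X FX Xz]; have /btensor_ileP := ub _ (ex_intro2 _ _ _ FX erefl).
by move/btensor_scale_sub; exact.
Qed.

HB.instance Definition _ :=
  isBSemiModule.Build K T btensor_scale_bsupl btensor_scale_bsupr.

Lemma bsum_pi (x : V) : bsum_tensor (hull [set x]).
Proof.
split; first exact: hull_tensor.
by exists [:: x]; apply: hull_mono => _ ->; rewrite /= inE.
Qed.

Definition btensor_pi (x : V) : T := BTensor (bsum_pi x).

End BTensorProduct.

(* Main.v *)
(** The sublevel sets [{x | f x <= w}] of a b-polylinear map [f] are tensors, so
    [f] is bounded on each tensor [X] lying in the hull of finitely many points,
    and [sup f(X) <= w] iff [X] lies in the sublevel set of [w]; b-linearity of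
    [X |-> sup f(X)] follows from this adjunction.  It is the only extension of
    [f], since every tensor is the supremum of the [btensor_pi x] for [x] in it. *)
Require Import Defs.
From HB Require Import structures.
From mathcomp Require Import all_boot all_algebra.
From mathcomp Require Import boolp classical_sets.

Set Implicit Arguments.
Unset Strict Implicit.
Unset Printing Implicit Defensive.

Import GRing.Theory.
Local Open Scope classical_set_scope.
Local Open Scope ring_scope.

(** Additivity is preservation of the supremum of the bounded pair [[set x; y]], so scalars and
    bounded suprema suffice. *)
Lemma b_linear_is_sup (K : bComSemiRingType) (V W : bSemiModType K)
    (p : V -> W) :
  (forall k x, p (k *: x) = k *: p x) ->
  (forall X, bounded X -> is_sup (p @` X) (p (bsup X))) -> b_linear p.
Proof.
move=> pZ psup; split=> // [x y|X bX]; last exact/esym/is_sup_bsup/psup.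
rewrite -bsup2 -(is_sup_bsup (psup _ (bounded2 x y))).
by rewrite image_setU !image_set1 bsup2.
Qed.

Lemma b_linear_mono (K : bComSemiRingType) (V W : bSemiModType K) (p : V -> W)
    x y :
  b_linear p -> ile x y -> ile (p x) (p y).
Proof. by move=> [pD _ _]; rewrite /ile -pD => ->. Qed.

Lemma bounded_image (K : bComSemiRingType) (V W : bSemiModType K) (p : V -> W)
    (X : set V) :
  b_linear p -> bounded X -> bounded (p @` X).
Proof.
by move=> lp [u ub]; exists (p u) => _ [x /ub xu <-]; exact: b_linear_mono.
Qed.

Section CanonicalMap.
Context {K : bComSemiRingType} {A : pointedType} (V_ : A -> bSemiModType K).
Local Notation V := (forall a, V_ a).
Implicit Types (x : V) (X Z : btensor V_).

(** Since [hull [set x]] is the least tensor through [x], the closure properties of tensors become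
    inequalities between the [btensor_pi x]. *)
Lemma btensor_pi_ileP x Z : ile (btensor_pi x) Z <-> (Z : set V) x.
Proof.
split=> [/btensor_ileP piZ|Zx]; first by apply: piZ; exact: sub_hull.
by apply/btensor_ileP; apply: hull_min; [exact: btensor_tensor | move=> _ ->].
Qed.

(** Independence of the index lets a scalar, defined to act at [point], act on whichever component
    varies. *)
Lemma btensor_pi_scale k a x : btensor_pi (scale_at k a x) = k *: btensor_pi x.
Proof.
apply: btensor_ext => /=.
by rewrite hull_scale (hull_scale_indep _ _ a) image_set1.
Qed.

Lemma btensor_pi_polylinear : b_polylinear (fun x : V => btensor_pi x).
Proof.
move=> a x; apply: b_linear_is_sup => [k v|Y bY].
  by rewrite -(btensor_pi_scale k a) /scale_at dfwith_in dfwith2.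
apply: is_supP => [_ [v Yv <-]|Z ub].
  apply/btensor_pi_ileP.
  apply: (@tensor_dfwith_le _ _ V_ (hull _) a x v (bsup Y)).
  - exact: hull_tensor.
  - exact: bsup_ub.
  - exact: sub_hull.
apply/btensor_pi_ileP; apply: tensor_dfwith_bsup => // [|v Yv].
  exact: btensor_tensor.
by apply/btensor_pi_ileP/ub; exists v.
Qed.

Lemma btensor_sup_pi X :
  is_sup [set btensor_pi x | x in (X : set V)] X.
Proof.
apply: is_supP => [_ [x Xx <-]|Z ub]; first exact/btensor_pi_ileP.
by apply/btensor_ileP => x Xx; apply/btensor_pi_ileP/ub; exists x.
Qed.

End CanonicalMap.

Section Extension.
Context {K : bComSemiRingType} {A : pointedType} (V_ : A -> bSemiModType K).
Context (W : bSemiModType K).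
Local Notation V := (forall a, V_ a).
Variable f : V -> W.
Hypothesis lf : b_polylinear f.

Lemma polylinear_scale_at k a x : f (scale_at k a x) = k *: f x.
Proof. by have [_ fZ _] := lf a x; rewrite fZ dfwith_id. Qed.

Lemma polylinear0 : f 0 = 0.
Proof.
(* An index must exist here: on an empty product every map is vacuously b-polylinear. *)
rewrite -[in RHS](scale0r (f 0)) -(polylinear_scale_at 0 point).
by rewrite /scale_at scaler0 [dfwith _ _]dfwith_id.
Qed.

(** Scaling any one component by [k] turns [f x] into [k *: f x], whatever the index; the closure
    conditions along fibers are b-linearity and monotonicity in one variable. *)
Lemma tensor_sublevel w : tensor [set x | ile (f x) w].
Proof.
apply: mk_tensor => /=.
- by move=> a k x + b; rewrite !polylinear_scale_at.
- move=> a x Y bY Yw; have [_ _ ->//] := lf a x.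
  apply: bsup_least => [|_ [v /Yw vw <-]//].
  exact: (bounded_image (lf a x)).
- move=> a x u v uv; apply: ile_trans; exact: (b_linear_mono (lf a x)).
- by rewrite polylinear0; exact: ile0x.
Qed.

Lemma bounded_image_btensor (X : btensor V_) : bounded (f @` (X : set V)).
Proof.
(* The sublevel set of this sum is a tensor containing every point of [s], hence their hull and
   [X]. *)
case: X => X [_ [s Xs]] /=; exists (\sum_(x <- s) f x) => _ [x Xx <-].
apply: (hull_min (tensor_sublevel (\sum_(x <- s) f x)) _ (Xs _ Xx)).
move=> {x Xx} x /=; elim: s {Xs} => // y s IH.
rewrite inE big_cons => /orP[/eqP ->|/IH xs]; first exact: ile_addr.
exact: ile_trans xs (ile_addl _ _).
Qed.

(** By [bounded_image_btensor] this is a true supremum, never the default value of [bsup]. *)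
Definition tensor_ext (X : btensor V_) : W := bsup (f @` (X : set V)).

Lemma tensor_ext_ileP X w :
  ile (tensor_ext X) w <-> (X : set V) `<=` [set x | ile (f x) w].
Proof.
have bX := bounded_image_btensor X; split=> [Xw x Xx|Xw].
  by apply: ile_trans Xw; apply: bsup_ub => //; exists x.
by apply: bsup_least => // _ [x /Xw ? <-].
Qed.

Lemma tensor_ext_pi x : tensor_ext (btensor_pi x) = f x.
Proof.
apply: ile_anti.
  apply/tensor_ext_ileP; apply: hull_min; first exact: tensor_sublevel.
  by move=> _ ->; exact: ilexx.
apply: bsup_ub; first exact: bounded_image_btensor.
by exists x => //; exact: sub_hull.
Qed.

Lemma tensor_extZ k X : tensor_ext (k *: X) = k *: tensor_ext X.
Proof.
have bX := bounded_image_btensor X; rewrite [in RHS]/tensor_ext scaler_bsupr//.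
apply/esym/is_sup_bsup/is_supP => [_ [_ [x Xx <-] <-]|w ub].
  rewrite -(polylinear_scale_at k point).
  apply: bsup_ub; first exact: bounded_image_btensor.
  by exists (scale_at k point x) => //; apply: sub_hull; exists x.
(* [k *: X] is the hull of the points [scale_at k point x], so by the adjunction the bound need only
   be tested on these. *)
apply/tensor_ext_ileP; apply: hull_min; first exact: tensor_sublevel.
move=> _ [x Xx <-] /=; rewrite polylinear_scale_at; apply: ub.
by exists (f x) => //; exists x.
Qed.

Lemma tensor_ext_b_linear : b_linear tensor_ext.
Proof.
apply: b_linear_is_sup => [|F bF]; first exact: tensor_extZ.
apply: is_supP => [_ [X FX <-]|w ub].
  have /btensor_ileP XF := bsup_ub bF FX.
  apply/tensor_ext_ileP => x /XF; apply: (tensor_ext_ileP _ _).1; exact: ilexx.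
apply/tensor_ext_ileP; rewrite btensor_bsupE//; apply: hull_min.
  exact: tensor_sublevel.
by move=> x [X FX]; apply: (tensor_ext_ileP _ _).1; apply: ub; exists X.
Qed.

Lemma tensor_ext_unique g :
  b_linear g -> f = (fun x => g (btensor_pi x)) -> tensor_ext = g.
Proof.
move=> [_ _ gsup] fE; apply: functional_extensionality_dep => X.
have sX := btensor_sup_pi X.
(* The family of all [btensor_pi x] with [x] in [X] is bounded by [X] itself, so [g] preserves its
   supremum. *)
rewrite -[in RHS](is_sup_bsup sX) gsup; last by exists X; case: sX.
by rewrite image_comp /tensor_ext fE.
Qed.

End Extension.

Theorem theorem1 (K : bComSemiRingType) (A : pointedType)
    (V_ : A -> bSemiModType K) (W : bSemiModType K) :
  b_polylinear (fun x : forall a, V_ a => btensor_pi x) /\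
  forall f : (forall a, V_ a) -> W, b_polylinear f ->
    exists! f_tensor : btensor V_ -> W,
      b_linear f_tensor /\ f = (fun x => f_tensor (btensor_pi x)).
Proof.
split=> [|f lf]; first exact: btensor_pi_polylinear.
exists (tensor_ext f); split=> [|g [lg fE]]; last exact: tensor_ext_unique.
split; first exact: tensor_ext_b_linear.
by apply: functional_extensionality_dep => x; rewrite tensor_ext_pi.
Qed.
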